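(* Let $A_1,A_2,B_1,B_2$ be APPL types and let $X_1 : A_1, X_2 : A_2 \vdash M : \mathtt{G}(B_1 \times B_2)$ be an APPL program. Let $Y$ be a fresh random variable of type $B_1\times B_2$ bound to the output of $M$, and write $Y_1=\mathtt{proj}_1\,Y$, $Y_2=\mathtt{proj}_2\,Y$. Then the Lilac Hoare triple $$\{\ \mathbf{own}\,(X_1,X_2)\ \}\ M\ \{\ (Y_1,Y_2).\ \mathbf{C}_{x : A_1 \gets X_1}\big(\mathbf{own}\,X_2 * \mathbf{own}\,Y_1\big)\ \}$$ is valid if and only if there exists an APPL program $X_1 : A_1 \vdash \mathbf{Sim}(M) : \mathtt{G} B_1$ (a simulator) such that, for all $a_1\in[\![A_1]\!]$ and $a_2\in[\![A_2]\!]$, $$[\![\mathbf{Sim}(M)]\!](a_1) \;=\; [\![\,(Y_1,Y_2) \gets M;\ \mathtt{return}\ Y_1\,]\!](a_1,a_2)$$ as probability measures on $[\![B_1]\!]$ (i.e. the program equation $X_1:A_1, X_2:A_2 \vdash \mathbf{Sim}(M) = (Y_1,Y_2)\gets M;\ \mathtt{return}\ Y_1 : \mathtt{G}B_1$ holds).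
   Context: APPL. Types: $A ::= \mathtt{bool}\mid \mathbb{K}\mid \mathtt{index}\mid A_1\times\cdots\times A_n$, where $\mathbb K$ is a fixed finite abelian group; $[\![\mathtt{bool}]\!]=\{\mathtt T,\mathtt F\}$, $[\![\mathbb K]\!]=\mathbb K$, $[\![\mathtt{index}]\!]=\mathbb N$ (discrete), products interpreted as products of measurable spaces (all countably generated). Expressions $E$ are built from deterministic variables, random variables, constants, conditionals, tuples, projections and binary operations; in a deterministic context $\Gamma$ and random-variable context $\Delta=X_1:A_1,\dots,X_n:A_n$ an expression of type $A$ denotes a map $[\![E]\!]:[\![\Gamma]\!]\to\mathbf{Meas}([\![\Delta]\!],[\![A]\!])$, with $[\![\Delta]\!]=\prod_i[\![A_i]\!]$. Programs: $M ::= \mathtt{return}\ E \mid X\gets M;N \mid \mathtt{unif}\ \mathbb K \mid \mathtt{for}\,(X\gets E;\ i\gets n_s,\dots,n_e)\,\{M\}$. A program $\Delta\vdash M:\mathtt G A$ denotes a Markov kernel $[\![M]\!]$ from $[\![\Delta]\!]$ to $[\![A]\!]$: $\mathtt{return}\ E$ gives the Dirac measure at the value of $E$; $X\gets M;N$ is Kleisli composition (sample $a$ from $[\![M]\!](\delta)$, then run $[\![N]\!](\delta,a)$); $\mathtt{unif}\ \mathbb K$ is the uniform distribution on $\mathbb K$; the for-loop initialises $X$ to $E$ and for $i=n_s,\dots,n_e$ replaces $X$ by a sample of $M$ (which may use $i$ and $X$), returning the final $X$. A program in context $X_1$ is regarded as a program in context $X_1,X_2$ by ignoring $X_2$. Resources.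 Let $\Omega=[0,1]^{\mathbb N}$ with Borel $\sigma$-algebra $\Sigma_\Omega$. A resource is a probability space $(\mathcal F,\mu)$ with $\mathcal F\subseteq\Sigma_\Omega$ a sub-$\sigma$-algebra; $\mathcal M_{\mathrm{disint}}$ is the set of resources used by Lilac (those with $\mathcal F$ countably generated and $\mu$ extendable to a probability measure on $\Sigma_\Omega$). Order: $(\mathcal F,\mu)\sqsubseteq(\mathcal G,\nu)$ iff $\mathcal F\subseteq\mathcal G$ and $\nu|_{\mathcal F}=\mu$. The (partial) independent combination $(\mathcal F,\mu)\cdot(\mathcal G,\nu)$ is, when it exists, the unique $(\mathcal H,\lambda)$ with $\mathcal H=\sigma(\mathcal F\cup\mathcal G)$ and $\lambda(F\cap G)=\mu(F)\nu(G)$ for all $F\in\mathcal F$, $G\in\mathcal G$. For a measurable space $S$, $\mathrm{RV}(S)$ is the set of measurable maps $\Omega\to S$. For measurable $f:\Omega\to S$ and a probability measure $\mu'$ on $\Sigma_\Omega$, a $\mu'$-disintegration with respect to $f$ is a Markov kernel $s\mapsto\nu_s$ from $S$ to $\Omega$ with $\nu_s(f^{-1}(\{s\}))=1$ for $f_*\mu'$-almost all $s$ and $\mu'(E)=\int\nu_s(E)\,d(f_*\mu')(s)$ for all $E\in\Sigma_\Omega$. Formula semantics. Satisfaction $\gamma,D,\mathcal P\models\phi$ with $\gamma$ a valuation of deterministic variables, $D\in\mathrm{RV}([\![\Delta]\!])$, $\mathcal P\in\mathcal M_{\mathrm{disint}}$; write $E_{\gamma,D}=[\![E]\!](\gamma)\circ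 D$. (i) $\gamma,D,(\mathcal F,\mu)\models\mathbf{own}\,E$ iff $E_{\gamma,D}$ is $\mathcal F$-measurable. (ii) $\phi\wedge\psi$: both hold. (iii) $\gamma,D,\mathcal P\models\phi*\psi$ iff there are $\mathcal P_1,\mathcal P_2\in\mathcal M_{\mathrm{disint}}$ with $\mathcal P_1\cdot\mathcal P_2$ defined and $\sqsubseteq\mathcal P$, $\gamma,D,\mathcal P_1\models\phi$, $\gamma,D,\mathcal P_2\models\psi$. (iv) $\gamma,D,(\mathcal F,\mu)\models\mathbf C_{x:A\gets E}\phi$ iff for every probability measure $\mu'$ on $\Sigma_\Omega$ with $(\mathcal F,\mu)\sqsubseteq(\Sigma_\Omega,\mu')$ and every $\mu'$-disintegration $\{\nu_a\}_a$ with respect to $E_{\gamma,D}$, for $(E_{\gamma,D})_*\mu'$-almost every $a$, $\gamma[x\mapsto a],D,(\mathcal F,\nu_a|_{\mathcal F})\models\phi$. (v) $\gamma,D,\mathcal P\models\mathrm{wp}(M,X:A.\phi)$ (for $\Delta\vdash M:\mathtt GA$) iff for every $\mathcal P_f\in\mathcal M_{\mathrm{disint}}$, every probability measure $\mu$ on $\Sigma_\Omega$ with $\mathcal P_f\cdot\mathcal P\sqsubseteq(\Sigma_\Omega,\mu)$, and every auxiliary random variable $D_e\in\mathrm{RV}(S_e)$ (any measurable space $S_e$ interpreting a context), there exist $X\in\mathrm{RV}([\![A]\!])$, $\mathcal P'\in\mathcal M_{\mathrm{disint}}$ and a probability measure $\mu'$ on $\Sigma_\Omega$ with $\mathcal P_f\cdot\mathcal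 P'\sqsubseteq(\Sigma_\Omega,\mu')$, $\gamma,(D,X),\mathcal P'\models\phi$, and the law of $(D_e(\omega),D(\omega),v)$ where $\omega\sim\mu$, $v\sim[\![M]\!](D(\omega))$ equals the law of $(D_e(\omega),D(\omega),X(\omega))$ where $\omega\sim\mu'$. A Hoare triple $\{\phi\}\,M\,\{X.\psi\}$ is valid iff for all $\gamma,D,\mathcal P$, $\gamma,D,\mathcal P\models\phi$ implies $\gamma,D,\mathcal P\models\mathrm{wp}(M,X:A.\psi)$. Binding the output as $(Y_1,Y_2)$ means binding a variable $Y$ and writing $Y_k$ for $\mathtt{proj}_k\,Y$.
   Formalization: Resources in M_disint and random variables in RV (auxiliary ones included) are also required to have finite footprint (depend on finitely many coordinates of Ω); without this a frame (Σ_Ω, δ_w) makes the claim false for M = (k ← unif K; return (k,k)) when |K| ≥ 2. *)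

(* Defs.v *)
From HB Require Import structures.
From mathcomp Require Import all_boot all_order all_algebra finmap.
From mathcomp Require Import all_classical all_reals all_analysis.
From mathcomp Require Import measurable_realfun.

Set Implicit Arguments.
Unset Strict Implicit.
Unset Printing Implicit Defensive.

Import Order.TTheory GRing.Theory Num.Theory.
Import numFieldNormedType.Exports.

Local Open Scope classical_set_scope.
Local Open Scope ring_scope.
Local Open Scope ereal_scope.

Record meas := Meas { mdisp : measure_display; mcar :> measurableType mdisp }.

Definition munit : meas := Meas unit.
Definition mprod (S T : meas) : meas := Meas (S * T)%type.

(** Alias of [K] carrying the discrete sigma-algebra. *)
Definition discr (K : finZmodType) : Type := K.

Section discr_instances.
Variable K : finZmodType.
HB.instance Definition _ := Choice.on (discr K).
HB.instance Definition _ := isPointed.Build (discr K) (0 : K)%R.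
HB.instance Definition _ := @isMeasurable.Build default_measure_display
  (discr K) discrete_measurable (@discrete_measurable0 _)
  (@discrete_measurableC _) (@discrete_measurableU _).
End discr_instances.

Inductive ty : Type := TBool | TK | TIndex | TProd of seq ty.

Definition ctx := seq ty.

(** Contexts list the most recently bound variable first: the context
    [X_1 : A_1, ..., X_n : A_n] is [:: A_n; ...; A_1]. *)
Inductive var : ctx -> ty -> Type :=
| VZ A G : var (A :: G) A
| VS A B G : var G A -> var (B :: G) A.

Arguments VZ {A G}.
Arguments VS {A B G}.

Section types.
Variable K : finZmodType.

Fixpoint den_ty (A : ty) : meas :=
  match A with
  | TBool => Meas bool
  | TK => Meas (discr K)
  | TIndex => Meas nat
  | TProd As => (fix den_tys (As : seq ty) : meas :=
      match As with
      | [::] => munit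
      | A :: As => mprod (den_ty A) (den_tys As)
      end) As
  end.

Fixpoint den_ctx (G : ctx) : meas :=
  match G with
  | [::] => munit
  | A :: G => mprod (den_ctx G) (den_ty A)
  end.

Fixpoint lookup G A (x : var G A) : den_ctx G -> den_ty A :=
  match x in var G A return den_ctx G -> den_ty A with
  | VZ _ _ => fun g => g.2
  | VS _ _ _ x => fun g => lookup x g.1
  end.

Fixpoint tuple_proj As A (x : var As A) : den_ty (TProd As) -> den_ty A :=
  match x in var As A return den_ty (TProd As) -> den_ty A with
  | VZ _ _ => fun t => t.1
  | VS _ _ _ x => fun t => tuple_proj x t.2
  end.

Lemma measurable_lookup G A (x : var G A) : measurable_fun setT (lookup x).
Proof.
elim: x => [{}A {}G|{}A B {}G x IH] /=; first exact: measurable_snd.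
exact: (measurableT_comp IH measurable_fst).
Qed.

Lemma measurable_tuple_proj As A (x : var As A) :
  measurable_fun setT (tuple_proj x).
Proof.
elim: x => [{}A G|{}A B G x IH] /=; first exact: measurable_fst.
exact: (measurableT_comp IH measurable_snd).
Qed.

(** The set of primitive binary operations is left open: any family of
    measurable operations can be chosen. *)
Record opsig := OpSig {
  op : ty -> ty -> ty -> Type;
  op_sem : forall A B C, op A B C -> {mfun mprod (den_ty A) (den_ty B) >-> den_ty C}
}.

End types.

Arguments den_ctx : simpl nomatch.

Section syntax.
Variables (K : finZmodType) (S : opsig K).

(** [G] types the deterministic variables, [D] the random ones.  Constants of
    product types are tuples of constants. *)
Inductive expr (G D : ctx) : ty -> Type :=
| EDet A : var G A -> expr G D A
| ERnd A : var D A -> expr G D A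
| EBool : bool -> expr G D TBool
| EK : K -> expr G D TK
| EIndex : nat -> expr G D TIndex
| EIf A : expr G D TBool -> expr G D A -> expr G D A -> expr G D A
| ETuple As : exprs G D As -> expr G D (TProd As)
| EProj As A : var As A -> expr G D (TProd As) -> expr G D A
| EOp A B C : op S A B C -> expr G D A -> expr G D B -> expr G D C
with exprs (G D : ctx) : seq ty -> Type :=
| ENil : exprs G D [::]
| ECons A As : expr G D A -> exprs G D As -> exprs G D (A :: As).

(** Programs only see random variables, so the counter of a loop is one of
    them: in [For E ns ne M] the body [M] is typed in D, i : index, X : A.
    Both bounds are inclusive and the result is [E] when ne < ns. *)
Inductive prog : ctx -> ty -> Type :=
| Return D A : expr [::] D A -> prog D A
| Bind D A B : prog D A -> prog (A :: D) B -> prog D B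
| Unif D : prog D TK
| For D A : expr [::] D A -> nat -> nat -> prog [:: A, TIndex & D] A -> prog D A.

(** [Cond E phi] is C_{x : A <- E} phi, where x is the last deterministic
    variable of [phi]; [Wp M phi] is wp(M, X : A. phi), where X is the last
    random variable of [phi]. *)
Inductive formula : ctx -> ctx -> Type :=
| Own G D A : expr G D A -> formula G D
| And G D : formula G D -> formula G D -> formula G D
| Sep G D : formula G D -> formula G D -> formula G D
| Cond G D A : expr G D A -> formula (A :: G) D -> formula G D
| Wp G D A : prog D A -> formula G (A :: D) -> formula G D.

End syntax.

Arguments EDet {K S G D A}.
Arguments ERnd {K S G D A}.
Arguments EBool {K S G D}.
Arguments EK {K S G D}.
Arguments EIndex {K S G D}.
Arguments ENil {K S G D}.
Arguments Unif {K S D}.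

Scheme expr_mut := Induction for expr Sort Prop
with exprs_mut := Induction for exprs Sort Prop.

Section eval.
Variables (K : finZmodType) (S : opsig K) (G D : ctx).
Implicit Type g : den_ctx K G.

Fixpoint eval A (E : expr S G D A) g (d : den_ctx K D) : den_ty K A :=
  match E in expr _ _ _ A return den_ty K A with
  | EDet _ x => lookup x g
  | ERnd _ x => lookup x d
  | EBool b => b
  | EK k => k
  | EIndex n => n
  | EIf _ E E1 E2 => if eval E g d then eval E1 g d else eval E2 g d
  | ETuple _ Es => evals Es g d
  | EProj _ _ x E => tuple_proj x (eval E g d)
  | EOp _ _ _ o E1 E2 => op_sem o (eval E1 g d, eval E2 g d)
  end
with evals As (Es : exprs S G D As) g (d : den_ctx K D) : den_ty K (TProd As) :=
  match Es in exprs _ _ _ As return den_ty K (TProd As) with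
  | ENil => tt
  | ECons _ _ E Es => (eval E g d, evals Es g d)
  end.

Lemma measurable_eval A (E : expr S G D A) g : measurable_fun setT (eval E g).
Proof.
move: A E; apply: (@expr_mut K S G D
  (fun A E => measurable_fun setT (eval E g))
  (fun As Es => measurable_fun setT (evals Es g))) => /=.
- by move=> A x; exact: measurable_cst.
- by move=> A x; exact: measurable_lookup.
- by move=> b; exact: measurable_cst.
- by move=> b; exact: measurable_cst.
- by move=> b; exact: measurable_cst.
- by move=> A E mE E1 mE1 E2 mE2; exact: measurable_fun_ifT.
- by [].
- by move=> As A x E mE; exact: (measurableT_comp (measurable_tuple_proj _)).
- move=> A B C o E1 mE1 E2 mE2; apply: measurableT_comp => //.
  exact: measurable_fun_pair.
- exact: measurable_cst.
- by move=> A As E mE Es mEs; exact: measurable_fun_pair.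
Qed.

HB.instance Definition _ A (E : expr S G D A) g :=
  isMeasurableFun.Build _ _ _ _ (eval E g) (measurable_eval E g).

End eval.

Section kpre.
Context d d' d3 (X : measurableType d) (Y : measurableType d')
  (Z : measurableType d3) (R : realType).
Variables (f : {mfun X >-> Y}) (k : R.-pker Y ~> Z).

Definition kpre (x : X) : {measure set Z -> \bar R} := k (f x).

Let measurable_kpre U : measurable U -> measurable_fun [set: X] (kpre ^~ U).
Proof.
by move=> mU; exact: (measurableT_comp (measurable_kernel k U mU) (measurable_funPT f)).
Qed.

HB.instance Definition _ := isKernel.Build _ _ X Z R kpre measurable_kpre.

Let kpre_prob x : kpre x [set: Z] = 1.
Proof. exact: prob_kernel. Qed.

HB.instance Definition _ := Kernel_isProbability.Build _ _ X Z R kpre kpre_prob.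

End kpre.

(** Kleisli composition; [mkcomp] has no instance of probability kernel. *)
Section kbind.
Context d d' d3 (X : measurableType d) (Y : measurableType d')
  (Z : measurableType d3) (R : realType).
Variables (l : R.-pker X ~> Y) (k : R.-pker (X * Y) ~> Z).

Definition kbind : X -> {measure set Z -> \bar R} := mkcomp l k.

Let measurable_kbind U : measurable U -> measurable_fun [set: X] (kbind ^~ U).
Proof. exact: measurable_fun_mkcomp_sfinite. Qed.

HB.instance Definition _ := isKernel.Build _ _ X Z R kbind measurable_kbind.

Let kbind_prob x : kbind x [set: Z] = 1.
Proof.
rewrite /kbind /mkcomp /= /kcomp (eq_integral (cst 1)).
  by rewrite integral_cst// prob_kernel mule1.
by move=> y _; rewrite prob_kernel.
Qed.

HB.instance Definition _ := Kernel_isProbability.Build _ _ X Z R kbind kbind_prob.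

End kbind.

Section unif.
Variables (R : realType) (K : finZmodType).

Definition unif : set (discr K) -> \bar R :=
  mscale ((#|K|%:R : R)^-1%:nng)%R (@counting (discr K) R).

HB.instance Definition _ := Measure.on unif.

Let unif_setT : unif setT = 1.
Proof.
have fK : finite_set [set: discr K] by apply: (@finite_finset K).
rewrite /unif /mscale /= /counting asboolT//=.
have -> : #|` fset_set [set: discr K]| = #|K|.
  rewrite cardE; apply/perm_size/uniq_perm; rewrite ?fset_uniq ?enum_uniq//.
  by move=> k; rewrite mem_enum inE in_fset_set// in_setT.
rewrite -EFinM mulVf// pnatr_eq0 -lt0n; apply/card_gt0P; by exists 0%R.
Qed.

HB.instance Definition _ := Measure_isProbability.Build _ _ R unif unif_setT.
End unif.

Section den_prog.
Variables (R : realType) (K : finZmodType) (S : opsig K).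

Definition at_index (D A : meas) (i : nat) (da : D * A) : D * nat * A :=
  (da.1, i, da.2).

Lemma measurable_at_index D A i : measurable_fun setT (@at_index D A i).
Proof.
apply: measurable_fun_pair; last exact: measurable_snd.
by apply: measurable_fun_pair; [exact: measurable_fst|exact: measurable_cst].
Qed.

HB.instance Definition _ D A i :=
  isMeasurableFun.Build _ _ _ _ (@at_index D A i) (@measurable_at_index D A i).

Fixpoint den D A (M : prog S D A) : R.-pker (den_ctx K D) ~> (den_ty K A) :=
  match M in prog _ D A return R.-pker (den_ctx K D) ~> (den_ty K A) with
  | Return _ _ E => kdirac (measurable_eval E tt)
  | Bind _ _ _ M N => kbind (den M) (den N)
  | Unif _ => kprobability (measurable_cst (@unif R K : pprobability (discr K) R))
  | For _ _ E ns ne M =>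
      foldl (fun k i => kbind k (kpre (@at_index _ _ i) (den M)))
        (kdirac (measurable_eval E tt)) (index_iota ns ne.+1)
  end.

End den_prog.

Section cube.
Variable R : realType.

Definition unitI : Type := set_type `[0%R : R, 1%R].

HB.instance Definition _ := Topological.on unitI.

Let zero_in : (0%R : R) \in `[0%R : R, 1%R]%classic.
Proof. by rewrite inE /= in_itv /= lexx ler01. Qed.

HB.instance Definition _ := isPointed.Build unitI (exist _ 0%R zero_in).

Definition cube : Type := prod_topology (fun _ : nat => unitI).

HB.instance Definition _ := Topological.on cube.
HB.instance Definition _ := Pointed.on cube.

(** [0,1]^N with its Borel sigma-algebra. *)
Definition Omega : Type := g_sigma_algebraType (@open cube).

HB.instance Definition _ := Measurable.on Omega.

End cube.

Section resources.
Variable R : realType.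
Local Notation Omega := (Omega R).

(** [f] factors through the projection to the first [n] coordinates.  For an
    event [E : Omega -> Prop] this says E = E' x [0,1]^N with E' a subset of
    [0,1]^n. *)
Definition depends_on_first (n : nat) (T : Type) (f : Omega -> T) : Prop :=
  forall w w' : Omega, (forall i, (i < n)%N -> w i = w' i) -> f w = f w'.

Lemma depends_on_first_le m n T (f : Omega -> T) :
  (m <= n)%N -> depends_on_first m f -> depends_on_first n f.
Proof.
by move=> mn fm w w' ww'; apply: fm => i im; exact/ww'/(leq_trans im).
Qed.

(** A probability space (F, mu) with F included in the Borel sets; as F is a
    sigma-algebra, the measurable sets of [g_sigma_algebraType F] are those
    of F. *)
Record resource := Resource {
  rsigma : set (set Omega);
  rsigma_algebra : sigma_algebra setT rsigma;
  rsigma_sub : rsigma `<=` measurable;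
  rmu : probability (g_sigma_algebraType rsigma) R
}.

Definition rle (P Q : resource) : Prop :=
  rsigma P `<=` rsigma Q /\ forall E, rsigma P E -> rmu Q E = rmu P E.

(** [H] is the independent combination of [P] and [Q]. *)
Definition indep_comb (P Q H : resource) : Prop :=
  rsigma H = <<s rsigma P `|` rsigma Q >> /\
  forall F G, rsigma P F -> rsigma Q G -> rmu H (F `&` G) = rmu P F * rmu Q G.

(** The combination of [P] and [Q] is defined and lies below [Q']. *)
Definition comb_le (P Q Q' : resource) : Prop :=
  exists2 H, indep_comb P Q H & rle H Q'.

Section restr.
Variables (F : set (set Omega)) (sF : sigma_algebra setT F).
Variables (FO : F `<=` measurable) (nu : probability Omega R).

Let incl : Omega -> g_sigma_algebraType F := id.

Let measurable_incl : measurable_fun [set: Omega] incl.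
Proof.
move=> _ E; rewrite measurable_g_measurableTypeE// setTI => FE.
exact: FO.
Qed.

HB.instance Definition _ := isMeasurableFun.Build _ _ _ _ incl measurable_incl.

(** (F, nu|_F) *)
Definition restr : resource := Resource sF FO (distribution nu incl).

End restr.

Definition full (mu : probability Omega R) : resource :=
  restr (@sigma_algebra_measurable _ Omega) (@subset_refl _ measurable) mu.

Definition countably_generated (F : set (set Omega)) : Prop :=
  exists2 G : set (set Omega), countable G & F = <<s G >>.

Definition extendable (P : resource) : Prop :=
  exists mu : probability Omega R, rle P (full mu).

(** Without finite footprints a frame could own the whole Borel sigma-algebra
    (with a point mass, say), leaving no randomness to sample from. *)
Definition finite_footprint (F : set (set Omega)) : Prop :=
  exists n, forall E, F E -> depends_on_first n E.

Definition Mdisint (P : resource) : Prop :=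
  [/\ countably_generated (rsigma P), finite_footprint (rsigma P) & extendable P].

Record RV (S : meas) := MkRV {
  rv_fun :> {mfun Omega >-> S};
  rv_footprint : exists n, depends_on_first n rv_fun
}.

Section rv_pair.
Variables (S T : meas) (X : RV S) (Y : RV T).

Definition pair_fun (w : Omega) : mprod S T := (X w, Y w).

Let measurable_pair_fun : measurable_fun [set: Omega] pair_fun.
Proof. exact: measurable_fun_pair. Qed.

HB.instance Definition _ :=
  isMeasurableFun.Build _ _ _ _ pair_fun measurable_pair_fun.

Lemma pair_footprint : exists n, depends_on_first n pair_fun.
Proof.
have [[m Xm] [n Yn]] := (rv_footprint X, rv_footprint Y).
exists (maxn m n) => w w' ww'.
have Xmn := depends_on_first_le (leq_maxl m n) Xm.
have Ymn := depends_on_first_le (leq_maxr m n) Yn.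
by rewrite /pair_fun (Xmn w w')// (Ymn w w').
Qed.

Definition rv_pair : RV (mprod S T) := MkRV pair_footprint.

End rv_pair.

Definition disintegration (S : meas) (f : {mfun Omega >-> S})
    (mu : probability Omega R) (nu : R.-pker S ~> Omega) : Prop :=
  {ae distribution mu f, forall s, nu s (f @^-1` [set s]) = 1} /\
  forall E, measurable E -> mu E = \int[distribution mu f]_s nu s E.

End resources.

(** [k x] as a [probability]; the type of [k] only makes it a [measure]. *)
Section pker_prob.
Context d d' (X : measurableType d) (Y : measurableType d') (R : realType).
Variables (k : R.-pker X ~> Y) (x : X).

Definition kprob : set Y -> \bar R := k x.

HB.instance Definition _ := Measure.on kprob.
HB.instance Definition _ :=
  Measure_isProbability.Build _ _ R kprob (@prob_kernel _ _ _ _ _ k x).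

End pker_prob.

Section sat.
Variables (R : realType) (K : finZmodType) (S : opsig K).
Local Notation Omega := (Omega R).
Local Notation den_ty := (den_ty K).
Local Notation den_ctx := (den_ctx K).

(** E_{g,X} = [[E]](g) o X *)
Definition expr_rv G D A (E : expr S G D A) (g : den_ctx G)
    (X : RV R (den_ctx D)) : {mfun Omega >-> den_ty A} :=
  eval E g \o X.

Fixpoint sat G D (phi : formula S G D) :
    den_ctx G -> RV R (den_ctx D) -> resource R -> Prop :=
  match phi in formula _ G D
    return den_ctx G -> RV R (den_ctx D) -> resource R -> Prop with
  | Own _ _ _ E => fun g X P =>
      forall U, measurable U -> rsigma P (expr_rv E g X @^-1` U)
  | And _ _ phi psi => fun g X P => sat phi g X P /\ sat psi g X P
  | Sep _ _ phi psi => fun g X P =>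
      exists P1 P2, [/\ Mdisint P1, Mdisint P2, comb_le P1 P2 P,
        sat phi g X P1 & sat psi g X P2]
  | Cond _ _ A E phi => fun g X P =>
      forall mu, rle P (full mu) ->
      forall nu : R.-pker (den_ty A) ~> Omega,
        disintegration (expr_rv E g X) mu nu ->
      {ae distribution mu (expr_rv E g X), forall a,
        sat phi (g, a) X
          (restr (rsigma_algebra P) (@rsigma_sub _ P) (kprob nu a))}
  | Wp _ D A M phi => fun g X P =>
      forall Pf, Mdisint Pf ->
      forall mu : probability Omega R, comb_le Pf P (full mu) ->
      forall (De : ctx) (Xe : RV R (den_ctx De)),
      exists (Y : RV R (den_ty A)) (P' : resource R) (mu' : probability Omega R),
        [/\ Mdisint P', comb_le Pf P' (full mu'), sat phi g (rv_pair X Y) P' &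
          forall U : set (den_ctx De * den_ctx D * den_ty A), measurable U ->
            \int[mu]_w den R M (X w) [set v | U (Xe w, X w, v)] =
            mu' [set w | U (Xe w, X w, Y w)]]
  end.

Definition hoare G D A (phi : formula S G D) (M : prog S D A)
    (psi : formula S G (A :: D)) : Prop :=
  forall (g : den_ctx G) (X : RV R (den_ctx D)) (P : resource R),
    Mdisint P -> sat phi g X P -> sat (Wp M psi) g X P.

End sat.

(* Main.v *)
(* All types are countable and discrete, so everything is decided on atoms, and
   conditioning on an atom of positive mass is elementary.

   If the law of Y_1 given (X_1, X_2) only depends on X_1, sample the output of
   M and store it, encoded as a point of [0,1], in a coordinate of the cube
   outside all footprints.  The resource of the pair (X, Y) is then independent
   of the frame, and given X_1 = a the variables X_2 and Y_1 are independent.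

   Conversely, run M on X_1 = a1 and X_2 a fair coin between two values.  As X_1
   is constant, the constant kernel is a disintegration, so the postcondition
   says that X_2 and Y_1 are independent: the law of Y_1 is the same for both
   values.  Fixing X_2 to a constant (every type has one) is then a simulator. *)
From HB Require Import structures.
Require Import Defs.
From mathcomp Require Import all_boot all_order all_algebra.
From mathcomp Require Import all_classical all_reals all_analysis.
From mathcomp Require Import measurable_realfun lra.

Set Implicit Arguments.
Unset Strict Implicit.
Unset Printing Implicit Defensive.

Import Order.TTheory GRing.Theory Num.Theory.
Import numFieldNormedType.Exports.

Local Open Scope classical_set_scope.
Local Open Scope ring_scope.
Local Open Scope ereal_scope.

(** * Countable discrete spaces *)

Lemma measurable_set_cst d (T : measurableType d) (P : Prop) :
  measurable [set _ : T | P].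
Proof.
case: (pselect P) => HP.
  by rewrite (_ : [set _ | _] = setT)//; apply/seteqP; split.
by rewrite (_ : [set _ | _] = set0)//; apply/seteqP; split.
Qed.

(** Only atoms are required to be measurable, a condition that passes to products; countability then
    makes every subset measurable. *)
Definition countable_discrete (S : meas) : Prop :=
  countable [set: S] /\ forall s : S, measurable [set s].

Section countable_discrete.
Variable S : meas.
Hypothesis dS : countable_discrete S.

Lemma discrete_measurableP (U : set S) : measurable U.
Proof.
have [cS mS] := dS.
by apply: countable_measurable => //; exact: sub_countable (subset_card_le _) cS.
Qed.

Lemma discrete_measurable_fun d (T : measurableType d) (f : T -> S) :
  (forall s, measurable (f @^-1` [set s])) -> measurable_fun setT f.
Proof.
move=> mf _ U _; rewrite setTI.
have -> : f @^-1` U = \bigcup_s (f @^-1` [set s] `&` [set _ | U s]).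
  apply/seteqP; split => [t Ut|t [s _ [/= <-]]]//; by exists (f t).
apply: countable_bigcupT_measurable; first exact: dS.1.
by move=> s; apply: measurableI => //; exact: measurable_set_cst.
Qed.

(** A preimage is the countable union over [s] of rectangles, each a preimage under a section times
    an atom. *)
Lemma discrete_measurable_prod d d' (T : measurableType d)
    (Z : measurableType d') (f : T * S -> Z) :
  (forall s, measurable_fun setT (fun t => f (t, s))) -> measurable_fun setT f.
Proof.
move=> mf _ U mU; rewrite setTI.
have -> : f @^-1` U = \bigcup_s (((fun t => f (t, s)) @^-1` U) `*` [set s]).
  apply/seteqP; split => [[t s] Ut|[t s] [s' _ [/= Us ->]]]//.
  by exists s.
apply: countable_bigcupT_measurable; first exact: dS.1.
move=> s; apply: measurableX; last exact: dS.2.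
by rewrite -[X in measurable X]setTI; exact: mf.
Qed.

Lemma discrete_eq_measure (R : realType) (m1 m2 : {measure set S -> \bar R}) :
  (forall s, m1 [set s] = m2 [set s]) -> forall U, m1 U = m2 U.
Proof.
move=> m12 U; have [e einj] := countable_injP _ dS.1.
(* The enumeration [e] cuts [U] into countably many disjoint pieces, each empty or an atom, so
   countable additivity applies. *)
pose V n := U `&` e @^-1` [set n].
have -> : U = \bigcup_n V n.
  by apply/seteqP; split => [s Us|s [n _ []]]//; exists (e s).
have tV : trivIset setT V.
  by move=> i j _ _ [s [[_ <-] [_ <-]]].
rewrite !measure_bigcup//; last 2 first.
  by move=> *; exact: discrete_measurableP.
  by move=> *; exact: discrete_measurableP.
apply: eq_eseriesr => n _.
have [[s [Us es]]|V0] := pselect (V n !=set0); last first.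
  by move/set0P/negP/negPn/eqP : V0 => ->; rewrite !measure0.
have -> : V n = [set s].
  apply/seteqP; split => [s' [Us' es']|_ ->]//=.
  by apply: einj; rewrite ?in_setT// es es'.
exact: m12.
Qed.

Lemma discrete_ae (R : realType) (m : {measure set S -> \bar R}) :
  {ae m, forall s, m [set s] != 0}.
Proof.
pose N := [set s | m [set s] = 0].
have mN : measurable N by exact: discrete_measurableP.
exists N; split => // [|s /= /negP]; last by move=> /negPn/eqP.
rewrite -[N]setTI -/(mrestr m mN setT) (@discrete_eq_measure _ _ mzero)// => s.
rewrite /= /mrestr /mzero; have [Ns|Ns] := pselect (N s).
  by rewrite setIC setI1 ifT ?inE.
by rewrite setIC setI1 ifF ?measure0//; apply/negbTE; rewrite notin_setE.
Qed.

(** As functions of [U], both sides are measures on [S]: the image of [m] restricted to [F], and a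
    multiple of the image of [m]. Agreement on atoms therefore suffices. *)
Lemma discrete_indep d (T : measurableType d) (R : realType)
    (m : {measure set T -> \bar R}) (f : {mfun T >-> S}) (F : set T)
    (c : \bar R) :
  measurable F -> 0 <= c -> c \is a fin_num ->
  (forall s, m (F `&` f @^-1` [set s]) = c * m (f @^-1` [set s])) ->
  forall U, m (F `&` f @^-1` U) = c * m (f @^-1` U).
Proof.
move=> mF c0 cfin mFs U; rewrite [F `&` _]setIC.
have mf : measurable_fun setT f by exact: measurable_funPT.
have cE : (NngNum (fine_ge0 c0))%:num%:E = c by rewrite /= fineK.
pose m1 := mrestr m mF; pose m2 := mscale (NngNum (fine_ge0 c0)) m.
have -> : c * m (f @^-1` U) = m2 (f @^-1` U) by rewrite /m2 /= /mscale cE.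
rewrite -[LHS]/(pushforward m1 f U) -[RHS]/(pushforward m2 f U).
apply: discrete_eq_measure => s.
by rewrite /= /pushforward /m1 /m2 /= /mrestr /mscale cE setIC mFs.
Qed.

End countable_discrete.

(** * APPL types and contexts as countable discrete spaces *)

Lemma countable_discrete_unit : countable_discrete munit.
Proof. by split => [|s]//; exact: countableP. Qed.

Lemma countable_discrete_prod (S T : meas) :
  countable_discrete S -> countable_discrete T -> countable_discrete (mprod S T).
Proof.
move=> [cS mS] [cT mT]; split => [|[s t]].
  by rewrite -setXTT; exact: countableX.
rewrite [X in measurable X](_ : _ = [set s] `*` [set t]); first exact: measurableX.
by apply/seteqP; split => [_ ->|[_ _] [/= -> ->]].
Qed.

Section types.
Variable K : finZmodType.

Lemma countable_discrete_ty (A : ty) : countable_discrete (den_ty K A).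
Proof.
(* Types nest inside lists, hence a recursion by [fix] with an inner induction on the list of
   components. *)
move: A; fix IH 1 => -[| | |As].
- by split => //; exact: countableP.
- by split => //; exact: (countableP (setT : set K)).
- by split => //; exact: countableP.
elim: As => [|A As IHAs]; first exact: countable_discrete_unit.
exact: (@countable_discrete_prod (den_ty K A) (den_ty K (TProd As))).
Qed.

Lemma countable_discrete_ctx (G : ctx) : countable_discrete (den_ctx K G).
Proof.
elim: G => [|A G IH]; first exact: countable_discrete_unit.
by apply: countable_discrete_prod => //; exact: countable_discrete_ty.
Qed.

End types.

(** * Coordinates of the cube *)

Lemma continuous_prod_topology (X : topologicalType) (I : choiceType)
    (K : I -> topologicalType) (f : X -> prod_topology K) :
  (forall i, continuous (fun x => f x i : K i)) -> continuous f.
Proof.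
move=> cf x; apply/cvg_sup => i; move: x; apply/(@continuousP _ (initial_topology (@^~ i))) => A [B oB <-].
by move/continuousP : (cf i); exact.
Qed.

Section fresh_coordinate.
Variable R : realType.
Local Notation Omega := (Omega R).

Definition set_coord (n : nat) (c : unitI R) (w : Omega) : Omega :=
  fun i => if i == n then c else w i.

Lemma measurable_set_coord n c : measurable_fun setT (set_coord n c).
Proof.
apply: (@measurability _ _ Omega Omega setT (set_coord n c) (@open (cube R)))
  => // _ [U oU <-].
rewrite setTI; apply: sub_sigma_algebra.
suff /continuousP cf : continuous (set_coord n c : cube R -> cube R) by exact: cf.
apply: (@continuous_prod_topology (cube R) nat (fun=> unitI R)) => i.
have [->|ni] := eqVneq i n.
  rewrite (_ : (fun _ => _) = cst c); first exact: cst_continuous.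
  by apply/funext => w; rewrite /set_coord eqxx.
rewrite (_ : (fun _ => _) = @proj nat (fun=> unitI R) i); first exact: proj_continuous.
by apply/funext => w; rewrite /set_coord (negbTE ni).
Qed.

(** Points of [0,1] are closed, so the complement is the preimage of an open set under a continuous
    projection. *)
Lemma measurable_coord_eq n c : measurable [set w : Omega | w n = c].
Proof.
rewrite -[X in measurable X]setCK; apply: measurableC.
apply: sub_sigma_algebra.
have oc : @open (unitI R) (~` [set c]).
  exists (~` [set (val c)]).
    by rewrite openC; exact: closed_eq.
  by apply/seteqP; split => d; apply: contra_not; [move=> ->|move/val_inj].
have : continuous (@proj nat (fun=> unitI R) n : cube R -> unitI R)
  by exact: proj_continuous.
by move/continuousP => /(_ _ oc).
Qed.

End fresh_coordinate.

(** * Storing a sample in a fresh coordinate *)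

Section sample.
Variable R : realType.
Local Notation Omega := (Omega R).

(** An injection into the naturals is followed by [n] mapped to 1/(n+1). *)
Lemma unitI_encoding (T : Type) : countable [set: T] ->
  exists enc : T -> unitI R, injective enc.
Proof.
move=> /countable_injP[e einj].
have in01 (n : nat) : (n.+1%:R^-1 : R)%R \in `[0%R : R, 1%R]%classic.
  by rewrite inE/= in_itv/= invr_ge0 ler0n/= invf_le1 ?ltr0Sn// ler1n.
exists (fun t => exist _ ((e t).+1%:R^-1 : R)%R (in01 (e t))) => s t [/invr_inj/eqP].
by rewrite eqr_nat => /eqP[] /einj; apply; rewrite in_setT.
Qed.

Variables (T : meas) (dT : countable_discrete T).

Section decode.
Variables (enc : T -> unitI R) (n : nat).

Definition decode_coord (w : Omega) : T := xget point [set t | enc t = w n].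

Hypothesis enc_inj : injective enc.

Lemma set_coordK t w : decode_coord (set_coord n (enc t) w) = t.
Proof.
by apply: xget_unique => [|s]; rewrite /set_coord/= eqxx// => /enc_inj.
Qed.

Lemma measurable_decode_coord : measurable_fun setT decode_coord.
Proof.
pose A t : set Omega := [set w | w n = enc t].
have mA t : measurable (A t) by exact: measurable_coord_eq.
apply: (discrete_measurable_fun dT) => t.
(* [point] is also the default value, so its fibre contains every [w] whose coordinate [n] is not a
   code. *)
have [->|tp] := pselect (t = point).
  rewrite (_ : _ @^-1` _ = A point `|` ~` (\bigcup_t A t)).
    apply: measurableU => //; apply: measurableC.
    by apply: countable_bigcupT_measurable => //; exact: dT.1.
  apply/seteqP; split => w /=.
    rewrite /decode_coord; case: xgetP => [s -> /= sw sp|nA _].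
      by left; rewrite -sp /A/= sw.
    by right => -[s _ /= /esym]; exact: nA.
  case => [wp|nA].
    by apply: xget_unique => //= s; rewrite wp => /enc_inj.
  by apply: xgetPN => s /= sw; apply: nA; exists s.
rewrite (_ : _ @^-1` _ = A t)//; apply/seteqP; split => w /=.
  by rewrite /decode_coord; case: xgetP => [s -> /= sw <-|nA /esym].
by move=> wt; apply: xget_unique => //= s; rewrite wt => /enc_inj.
Qed.

Lemma decode_coord_footprint : exists m, depends_on_first m decode_coord.
Proof. by exists n.+1 => w w' ww'; rewrite /decode_coord ww'. Qed.

End decode.

(* A coordinate outside the footprint of the events stores the sample. *)
Lemma sample_fresh (mu : probability Omega R) (k : R.-pker Omega ~> T) (n : nat) :
  exists (Y : RV R T) (mu' : probability Omega R),
    forall E : Omega -> set T,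
      (forall t, measurable [set w | E w t]) -> depends_on_first n E ->
      mu' [set w | E w (Y w)] = \int[mu]_w k w (E w).
Proof.
have [enc enc_inj] := unitI_encoding dT.1.
pose Y0 : {mfun Omega >-> T} := HB.pack (decode_coord enc n)
  (isMeasurableFun.Build _ _ _ _ _ (measurable_decode_coord n enc_inj)).
pose Y : RV R T := @MkRV R T Y0 (decode_coord_footprint enc n).
(* [mu'] will be the law of [w] with coordinate [n] overwritten by the code of [t], for [w] drawn
   from [mu] and [t] from [k w]. The [unit] factor arises because [mu] enters as a kernel from
   [unit]. *)
pose h (p : (unit * Omega) * T) : Omega := set_coord n (enc p.2) p.1.2.
have mh : measurable_fun setT h.
  apply: (discrete_measurable_prod dT) => t.
  apply: (measurableT_comp (measurable_set_coord n (enc t))).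
  exact: measurable_snd.
pose l : R.-pker unit ~> Omega :=
  kprobability (measurable_cst (mu : pprobability Omega R)).
pose pr2 : {mfun (unit * Omega)%type >-> Omega} :=
  HB.pack (@snd unit Omega) (isMeasurableFun.Build _ _ _ _ _ measurable_snd).
pose N : R.-pker (unit * Omega)%type ~> Omega :=
  kbind (kpre pr2 k) (kdirac mh).
exists Y, (kprob (kbind l N) tt) => E mE En.
have mEY : measurable [set w | E w (Y w)].
  rewrite (_ : mkset _ = \bigcup_t ([set w | E w t] `&` Y @^-1` [set t])).
    apply: countable_bigcupT_measurable; first exact: dT.1.
    by move=> t; apply: measurableI => //; apply: measurable_funPTI; exact: dT.2.
  by apply/seteqP; split => [w Ew|w [t _ [/= + ->]]]//; exists (Y w).
rewrite /kprob/= /kbind /mkcomp /= /kcomp /kprobability /=.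
apply: eq_integral => w _; rewrite /kdirac/= /kpre /=.
rewrite /kcomp /dirac/=.
rewrite -[E w in RHS]setIT -integral_indic//; last exact: discrete_measurableP.
apply: eq_integral => t _; congr (_%:E).
(* [E] reads only coordinates below [n], so overwriting coordinate [n] leaves it unchanged. *)
have Ew : E (h (tt, w, t)) = E w.
  apply: En => i ni; rewrite /h /set_coord ifF//.
  by apply/negbTE; rewrite neq_ltn ni.
rewrite /indic; congr (nat_of_bool _)%:R.
by apply/idP/idP; rewrite !inE/= Ew set_coordK.
Qed.

End sample.

(** * Elementary facts on measures and extended reals *)

Lemma ae_atom d (T : measurableType d) (R : realType)
    (m : {measure set T -> \bar R}) (P : T -> Prop) (a : T) :
  {ae m, forall x, P x} -> measurable [set a] -> m [set a] != 0 -> P a.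
Proof.
move=> aeP ma ma0; apply: contrapT => nPa; move/eqP: ma0; apply.
by apply: measure_negligible => //; apply: negligibleS aeP => _ ->.
Qed.

Lemma mule_pinjl (R : realDomainType) (x y z : \bar R) :
  x \is a fin_num -> 0 < x -> x * y = x * z -> y = z.
Proof.
move=> xfin x0 xyz; apply: le_anti; apply/andP.
by split; rewrite -(lee_pmul2l xfin x0) xyz.
Qed.

Lemma probability_setI1 d (T : measurableType d) (R : realType)
    (m : probability T R) (A B : set T) :
  measurable A -> measurable B -> m B = 1 -> m (A `&` B) = m A.
Proof.
move=> mA mB mB1; rewrite [RHS](measureDI m mA mB) [X in _ = X + _](_ : _ = 0) ?add0e//.
apply/eqP; rewrite -measure_le0.
have <- : m (~` B) = 0 by rewrite probability_setC// mB1 subee.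
by apply: le_measure; rewrite ?inE//; [exact: measurableD|exact: measurableC].
Qed.

(** * Resources and their independent combination *)

Section resources.
Variable R : realType.
Local Notation Omega := (Omega R).

Lemma rle_restr_full (F : set (set Omega)) (sF : sigma_algebra setT F)
    (FO : F `<=` measurable) (mu : probability Omega R) :
  rle (restr sF FO mu) (full mu).
Proof. by split. Qed.

Lemma rsigmaT (P : resource R) : rsigma P setT.
Proof. by have [P0 PC _] := rsigma_algebra P; rewrite -(setD0 setT); exact: PC. Qed.

(** The combination is realised by restricting [mu] to the generated sigma-algebra, which leaves
    only the product formula to check. *)
Lemma comb_le_restr (P Q : resource R) (F : set (set Omega))
    (sF : sigma_algebra setT F) (FO : F `<=` measurable)
    (mu : probability Omega R) :
  rsigma P `<=` F -> rsigma Q `<=` F ->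
  (forall E E', rsigma P E -> rsigma Q E' ->
    mu (E `&` E') = rmu P E * rmu Q E') ->
  comb_le P Q (restr sF FO mu).
Proof.
move=> PF QF PQ.
have GF : <<s rsigma P `|` rsigma Q >> `<=` F.
  by apply: smallest_sub => // E [/PF|/QF].
exists (restr (smallest_sigma_algebra setT (rsigma P `|` rsigma Q))
  (subset_trans GF FO) mu) => //.
Qed.

Lemma comb_leE (P Q Q' : resource R) E E' :
  comb_le P Q Q' -> rsigma P E -> rsigma Q E' ->
  rmu Q' (E `&` E') = rmu P E * rmu Q E'.
Proof.
move=> [H [sH HPQ] [HF HQ']] PE QE'.
rewrite -HPQ// HQ'// sH.
have sG := smallest_sigma_algebra setT (rsigma P `|` rsigma Q).
rewrite -(measurable_g_measurableTypeE sG).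
apply: (@measurableI _ (g_sigma_algebraType <<s rsigma P `|` rsigma Q >>));
  rewrite measurable_g_measurableTypeE//; apply: sub_sigma_algebra; by [left|right].
Qed.

Lemma comb_lel (P Q Q' : resource R) E :
  comb_le P Q Q' -> rsigma P E -> rmu Q' E = rmu P E.
Proof.
move=> PQ PE; have QT1 : rmu Q (setT : set Omega) = 1 by exact: probability_setT.
by rewrite -[E in LHS]setIT (comb_leE PQ PE (rsigmaT Q)) QT1 mule1.
Qed.

Lemma comb_ler (P Q Q' : resource R) E :
  comb_le P Q Q' -> rsigma Q E -> rmu Q' E = rmu Q E.
Proof.
move=> PQ QE; have PT1 : rmu P (setT : set Omega) = 1 by exact: probability_setT.
by rewrite -[E in LHS]setTI (comb_leE PQ (rsigmaT P) QE) PT1 mul1e.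
Qed.

Lemma full_muE (mu : probability Omega R) E : rmu (full mu) E = mu E.
Proof. by []. Qed.

(** * Resources generated by a random variable *)

Section rv_resource.
Variables (S : meas) (Z : {mfun Omega >-> S}).

Definition rv_sigma : set (set Omega) := preimage_set_system setT Z measurable.

Lemma rv_sigma_algebra : sigma_algebra setT rv_sigma.
Proof. exact/sigma_algebra_preimage/sigma_algebra_measurable. Qed.

Lemma rv_sigma_preimage U : measurable U -> rv_sigma (Z @^-1` U).
Proof. by move=> mU; exists U; rewrite ?setTI. Qed.

Lemma rv_sigmaP E : rv_sigma E -> exists2 U, measurable U & E = Z @^-1` U.
Proof. by move=> [U mU <-]; exists U; rewrite ?setTI. Qed.

Lemma rv_sigma_sub : rv_sigma `<=` measurable.
Proof. by move=> _ /rv_sigmaP[U mU ->]; exact: measurable_funPTI. Qed.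

(** The least resource below [full mu] that owns [Z]; it is the witness wherever ownership of a
    variable has to be provided. *)
Definition rv_resource (mu : probability Omega R) : resource R :=
  restr rv_sigma_algebra rv_sigma_sub mu.

(** The preimages of atoms form a countable generating family, and the events inherit the footprint
    of [Z]. *)
Lemma rv_resource_Mdisint mu : countable_discrete S ->
  (exists n, depends_on_first n Z) -> Mdisint (rv_resource mu).
Proof.
move=> [cS mS] [n Zn]; split; last by exists mu; exact: rle_restr_full.
- pose G := [set Z @^-1` [set s] | s in setT].
  exists G; first exact: sub_countable (card_image_le _ _) cS.
  apply/seteqP; split => [_ /rv_sigmaP[U _ ->]|].
    rewrite (_ : Z @^-1` U = \bigcup_(s in U) Z @^-1` [set s]); last first.
      by apply/seteqP; split => [w Uw|w [s Us /= ->]]//; exists (Z w).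
    have sG := smallest_sigma_algebra setT G.
    rewrite -(measurable_g_measurableTypeE sG).
    rewrite -[U]setTI bigcup_mkcondr.
    apply: (@countable_bigcupT_measurable _ (g_sigma_algebraType <<s G>>)) => // s.
    case: ifPn => _; last exact: measurable0.
    rewrite measurable_g_measurableTypeE//; apply: sub_sigma_algebra.
    by exists s.
  apply: smallest_sub; first exact: rv_sigma_algebra.
  by move=> _ [s _ <-]; exact: rv_sigma_preimage.
- exists n => _ /rv_sigmaP[U _ ->] w w' /Zn ww'.
  by rewrite /preimage/= ww'.
Qed.

End rv_resource.

Lemma rv_sigma_factor (S T : meas) (Z : {mfun Omega >-> S})
    (f : {mfun Omega >-> T}) (g : S -> T) :
  measurable_fun setT g -> f = g \o Z :> (Omega -> T) ->
  rv_sigma f `<=` rv_sigma Z.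
Proof.
move=> mg fgZ _ /rv_sigmaP[U mU ->]; rewrite fgZ comp_preimage.
by apply: rv_sigma_preimage; rewrite -[X in measurable X]setTI; exact: mg.
Qed.

(** * Disintegrations at atoms *)

(** Almost every [nu s] is concentrated on its own fibre, so only [s = a] contributes to the
    integral. On atoms of positive mass, [nu a] is thus elementary conditional probability. *)
Lemma disintegration_cond (S : meas) (f : {mfun Omega >-> S})
    (mu : probability Omega R) (nu : R.-pker S ~> Omega) (a : S) (E : set Omega) :
  countable_discrete S -> disintegration f mu nu ->
  nu a (f @^-1` [set a]) = 1 ->
  measurable E ->
  mu (E `&` f @^-1` [set a]) = nu a E * mu (f @^-1` [set a]).
Proof.
move=> dS [nu1 muE] nua mE.
have mfs s : measurable (f @^-1` [set s]).
  by apply: measurable_funPTI; exact: dS.2.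
have ma := dS.2 a.
have mEa : measurable (E `&` f @^-1` [set a]) by exact: measurableI.
rewrite muE//.
have -> : mu (f @^-1` [set a]) = \int[distribution mu f]_s (\1_[set a] s)%:E.
  by rewrite integral_indic// setIT.
rewrite -ge0_integralZl//; last first.
  by apply/measurable_EFinP; exact: measurable_indic.
apply: ae_eq_integral => //.
- exact: measurable_kernel.
- apply: emeasurable_funM => //.
  by apply/measurable_EFinP; exact: measurable_indic.
apply: filterS nu1 => s nus _.
have [->|sa] := eqVneq s a.
  rewrite indicE mem_set// mule1.
  by rewrite -/(kprob nu a _) -/(kprob nu a _) probability_setI1.
rewrite indicE memNset ?mule0; last exact/eqP.
apply/eqP; rewrite -measure_le0.
have <- : nu s (~` (f @^-1` [set s])) = 0.
  by rewrite -/(kprob nu s _) probability_setC ?/kprob ?nus ?subee//.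
apply: le_measure; rewrite ?inE//; first exact: measurableC.
by move=> w [_ /= -> /esym/eqP]; apply/negP.
Qed.
(** The integrand is the constant [k x V] where [F] holds and [X = x], and vanishes elsewhere. *)
Lemma integral_kernel_atom (S T : meas) (X : {mfun Omega >-> S})
    (k : R.-pker S ~> T) (mu : probability Omega R) (F : set Omega) (x : S)
    (V : set T) :
  measurable F -> measurable [set x] ->
  \int[mu]_w k (X w) [set t | (F `&` X @^-1` [set x]) w /\ V t] =
  mu (F `&` X @^-1` [set x]) * k x V.
Proof.
move=> mF mx; pose D := F `&` X @^-1` [set x].
have mD : measurable D by apply: measurableI => //; exact: measurable_funPTI.
rewrite (eq_integral (fun w => (\1_D w)%:E * k x V)).
  rewrite ge0_integralZr// ?integral_indic// ?setIT//.
  by apply/measurable_EFinP; exact: measurable_indic.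
move=> w _; rewrite indicE.
have [Dw|nDw] := pselect (D w).
  rewrite mem_set// mul1e (_ : mkset _ = V); first by case: Dw => _ /= ->.
  by apply/seteqP; split => [t []|t Vt].
rewrite memNset// mul0e (_ : mkset _ = set0) ?measure0//.
by apply/seteqP; split => [t []|].
Qed.

(** The factorisation says that, given [f1 = a], the law of [h] is [q] whatever the value of [f2].
    This is independence under the conditional measure [nu a]. *)
Lemma disintegration_indep (S1 S2 T : meas) (f1 : {mfun Omega >-> S1})
    (f2 : {mfun Omega >-> S2}) (h : {mfun Omega >-> T})
    (mu : probability Omega R) (nu : R.-pker S1 ~> Omega) (a : S1)
    (q : probability T R) :
  countable_discrete S1 -> countable_discrete S2 ->
  disintegration f1 mu nu -> nu a (f1 @^-1` [set a]) = 1 ->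
  mu (f1 @^-1` [set a]) != 0 ->
  (forall b V, measurable V ->
    mu (f1 @^-1` [set a] `&` f2 @^-1` [set b] `&` h @^-1` V) =
    mu (f1 @^-1` [set a] `&` f2 @^-1` [set b]) * q V) ->
  forall U V, measurable V ->
    nu a (f2 @^-1` U `&` h @^-1` V) = nu a (f2 @^-1` U) * nu a (h @^-1` V).
Proof.
move=> d1 d2 dis nua p0 fac U V mV.
have mf1 : measurable (f1 @^-1` [set a]) by apply: measurable_funPTI; exact: d1.2.
have mf2 b : measurable (f2 @^-1` [set b]) by apply: measurable_funPTI; exact: d2.2.
have mh : measurable (h @^-1` V) by exact: measurable_funPTI.
have pfin : mu (f1 @^-1` [set a]) \is a fin_num by exact: fin_num_measure.
have qfin : q V \is a fin_num by exact: fin_num_measure.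
(* On atoms of [f2], multiplying by the positive mass of [f1 = a] turns the claim into the
   hypothesis on [mu]. The case [U = setT] then identifies [q V] as the law of [h] under [nu a]. *)
have main : forall U, nu a (h @^-1` V `&` f2 @^-1` U) = q V * nu a (f2 @^-1` U).
  apply: (discrete_indep d2) => // b.
  suff mulp : mu (f1 @^-1` [set a]) * nu a (h @^-1` V `&` f2 @^-1` [set b]) =
      mu (f1 @^-1` [set a]) * (q V * nu a (f2 @^-1` [set b])).
    by apply: (mule_pinjl pfin _ mulp); rewrite lt0e p0/=.
  rewrite muleC -(disintegration_cond d1 dis)//; last exact: measurableI.
  rewrite muleCA muleC [mu _ * _]muleC -(disintegration_cond d1 dis)//.
  rewrite [f2 @^-1` _ `&` f1 @^-1` _]setIC -fac//; congr (mu _).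
  by rewrite setIC [h @^-1` V `&` _]setIC setIA.
have nuT : nu a (h @^-1` V) = q V.
  by have := main setT; rewrite preimage_setT setIT prob_kernel mule1.
by rewrite setIC main muleC nuT.
Qed.

End resources.

(** * From a simulator to the triple *)

Lemma den_bind_return (R : realType) (K : finZmodType) (S : opsig K) D A B
    (E : expr S [::] D A) (N : prog S (A :: D) B) (x : den_ctx K D) U :
  measurable U ->
  den R (Bind (Return E) N) x U = den R N (x, Defs.eval E tt x) U.
Proof.
move=> mU; rewrite /= /kbind /mkcomp /= /kcomp integral_dirac//.
  by rewrite diracT mul1e.
apply: measurableT_comp (measurable_kernel (den R N) U mU) _.
by apply: measurable_fun_pair; [exact: measurable_cst|exact: measurable_id].
Qed.

Section noninterference.
Variables (R : realType) (K : finZmodType) (S : opsig K).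
Variables (A1 A2 B1 B2 : ty) (M : prog S [:: A2; A1] (TProd [:: B1; B2])).
Local Notation Omega := (Omega R).

Lemma den_bind_proj1 (x : den_ctx K [:: A2; A1]) U : measurable U ->
  den R (Bind M (Return (EProj VZ (ERnd VZ)))) x U =
  den R M x [set y | U y.1].
Proof.
move=> mU; rewrite /= /kbind /mkcomp /= /kcomp.
have mU1 : measurable [set y : den_ty K (TProd [:: B1; B2]) | U y.1].
  exact: (discrete_measurableP (countable_discrete_ty K _)).
by rewrite -[X in den R M x X]setIT -integral_indic.
Qed.

Lemma hoare_of_simulator (q : R.-pker den_ty K A1 ~> den_ty K B1) :
  (forall (a1 : den_ty K A1) (a2 : den_ty K A2) (V : set (den_ty K B1)),
    q a1 V = den R M (tt, a1, a2) [set y | V y.1]) ->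
  hoare R (G := [::])
    (Own (ETuple (ECons (ERnd (VS VZ)) (ECons (ERnd VZ) ENil))))
    M
    (Cond (ERnd (VS (VS VZ)))
       (Sep (Own (ERnd (VS VZ))) (Own (EProj VZ (ERnd VZ))))).
Proof.
move=> simM g X P mP ownX Pf mPf mu fr De Xe.
have dT := countable_discrete_ty K (TProd [:: B1; B2]).
have dD := countable_discrete_ctx K [:: A2; A1].
(* The owned tuple is [(a1, (a2, tt))] while the context is [((tt, a1), a2)]; rearranging shows that
   [P] owns [X] itself. *)
have PX V : rsigma P (X @^-1` V).
  pose U := [set u : den_ty K (TProd [:: A1; A2]) | V (tt, u.1, u.2.1)].
  have := ownX U (discrete_measurableP (countable_discrete_ty K _) _).
  rewrite (_ : _ @^-1` U = X @^-1` V)//; apply/seteqP; split => w;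
    by rewrite /U /preimage /=; case: (X w) => -[[] ? ?].
have mX V : measurable (X @^-1` V) by exact: (rsigma_sub (PX V)).
have [[[_ [nf fn] _] [nX Xn]] [ne Xen]] := (mPf, rv_footprint X, rv_footprint Xe).
(* The fresh coordinate must lie outside the footprints of the frame, of [X] and of the auxiliary
   variable. *)
pose n := maxn nf (maxn nX ne).
have {}fn E : rsigma Pf E -> depends_on_first n E.
  by move=> /fn; apply: depends_on_first_le; rewrite leq_max leqnn.
have {}Xn : depends_on_first n X.
  by apply: depends_on_first_le Xn; rewrite !leq_max leqnn orbT.
have {}Xen : depends_on_first n Xe.
  by apply: depends_on_first_le Xen; rewrite !leq_max leqnn !orbT.
have [Y [mu' mu'E]] := sample_fresh dT mu (kpre X (den R M)) n.
have mu'L F x V : measurable F -> depends_on_first n F ->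
    mu' (F `&` X @^-1` [set x] `&` Y @^-1` V) =
    mu (F `&` X @^-1` [set x]) * den R M x V.
  move=> mF Fn.
  pose E w := [set t | (F `&` X @^-1` [set x]) w /\ V t].
  rewrite -[LHS]/(mu' [set w | E w (Y w)]) mu'E.
  - exact: (integral_kernel_atom X (den R M) mu V mF (dD.2 x)).
  - move=> t; rewrite (_ : mkset _ = (F `&` X @^-1` [set x]) `&` [set _ | V t]).
      by apply: measurableI; [exact: measurableI|exact: measurable_set_cst].
    by apply/seteqP; split.
  - by move=> w w' ww'; rewrite /E /setI /preimage/= (Fn _ _ ww') (Xn _ _ ww').
pose DY := [:: TProd [:: B1; B2]; A2; A1].
have dZ := countable_discrete_ctx K DY.
pose Z : RV R (den_ctx K DY) := rv_pair X Y.
exists Y, (rv_resource Z mu'), mu'; split.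
- exact: rv_resource_Mdisint dZ (rv_footprint Z).
- apply: comb_le_restr.
  + exact: rsigma_sub.
  + exact: rv_sigma_sub.
  move=> F _ PfF /rv_sigmaP[U mU ->].
  have mF : measurable F by exact: rsigma_sub PfF.
  rewrite -(comb_lel fr PfF) full_muE.
  (* On an atom of [Z], [mu'L] splits off the law of [Y], which depends on [x] only; [X] is
     independent of [F] because [P] owns it. *)
  apply: (discrete_indep dZ) => //; first exact: fin_num_measure.
  move=> [x y].
  have -> : Z @^-1` [set (x, y)] = X @^-1` [set x] `&` Y @^-1` [set y].
    by apply/seteqP; split => [w [/= -> ->]|w [/= <- <-]].
  rewrite setIA [LHS]mu'L//; last exact: fn.
  rewrite -[X @^-1` _ in RHS]setTI [X in _ = _ * X]mu'L// setTI muleA.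
  congr (_ * _); rewrite -!full_muE (comb_leE fr PfF (PX _)).
  by rewrite (comb_lel fr PfF) (comb_ler fr (PX _)).
- move=> mu2 [_ P'mu2] nu dis.
  set f1 := expr_rv _ _ _ in dis *.
  have d1 : countable_discrete (den_ty K A1) by exact: countable_discrete_ty.
  have d2 : countable_discrete (den_ty K A2) by exact: countable_discrete_ty.
  (* [mu2] is an arbitrary extension of the resource of [Z], so it is known only on events about
     [Z]. *)
  have mu2Z W : mu2 (Z @^-1` W) = mu' (Z @^-1` W).
    rewrite -[LHS]/(rmu (full mu2) (Z @^-1` W)) P'mu2//.
    exact: rv_sigma_preimage (discrete_measurableP dZ W).
  have [nZ Zn] := rv_footprint Z.
  have footE A G (E : expr S G DY A) g' : exists n, depends_on_first n (expr_rv E g' Z).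
    by exists nZ => w w' ww'; rewrite /expr_rv /= (Zn _ _ ww').
  have [nu1 _] := dis.
  (* Almost every [a] is an atom of positive mass on whose fibre [nu a] is concentrated. *)
  move: (discrete_ae d1 (distribution mu2 f1)) nu1; apply: filterS2 => a p0 nua.
  pose ga : den_ctx K [:: A1] := (g, a).
  pose f2 := expr_rv (ERnd (VS VZ) : expr S _ DY A2) ga Z.
  pose h := expr_rv (EProj VZ (ERnd VZ) : expr S _ DY B1) ga Z.
  exists (rv_resource f2 (kprob nu a)), (rv_resource h (kprob nu a)); split.
  + by apply: rv_resource_Mdisint; [exact: countable_discrete_ty|exact: footE].
  + by apply: rv_resource_Mdisint; [exact: countable_discrete_ty|exact: footE].
  + apply: comb_le_restr.
    * exact: (rv_sigma_factor (measurable_eval _ _)).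
    * exact: (rv_sigma_factor (measurable_eval _ _)).
    move=> _ _ /rv_sigmaP[U mU ->] /rv_sigmaP[V mV ->].
    (* The simulator at [a] is the law of [Y_1] common to all values [b] of [X_2]. *)
    apply: (disintegration_indep (q := kprob q a) d1 d2 dis nua p0) => // b W mW.
    have XE : f1 @^-1` [set a] `&` f2 @^-1` [set b] = X @^-1` [set (tt, a, b)].
      apply/seteqP; split => w; rewrite /preimage/=.
        by move=> []; rewrite /f1 /f2 /=; case: (X w) => -[[] ? ?] /= -> ->.
      by rewrite /f1 /f2 /= => ->.
    rewrite XE.
    (* Both events are written as preimages under [Z], where [mu2] can be replaced by [mu']. *)
    rewrite -[LHS]/(mu2 (Z @^-1` [set z | z.1 = (tt, a, b) /\ W z.2.1])) mu2Z.
    rewrite -[X in _ = mu2 X * _]/(Z @^-1` [set z | z.1 = (tt, a, b)]) mu2Z.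
    rewrite -[LHS]/(mu' (X @^-1` [set (tt, a, b)] `&` Y @^-1` [set y | W y.1])).
    rewrite -[X in _ = mu' X * _]/(X @^-1` [set (tt, a, b)]).
    rewrite -[X in X `&` _]setTI mu'L// setTI -simM; congr (_ * _).
    rewrite -[X in _ = mu' X]setTI -[X in _ = mu' X]setIT
      -[X in _ = mu' (_ `&` X)](preimage_setT Y).
    by rewrite mu'L// setTI prob_kernel mule1.
  + by move=> V mV; exact: rv_sigma_preimage.
  + by move=> V mV; exact: rv_sigma_preimage.
- move=> U mU.
  (* Apart from the sampled value, the event reads only [Xe] and [X], hence the first [n]
     coordinates. *)
  apply/esym; apply: (mu'E (fun w => [set t | U (Xe w, X w, t)])).
  + move=> t; rewrite (_ : mkset _ = (fun w => (Xe w, X w)) @^-1` [set d | U (d, t)])//.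
    rewrite -[X in measurable X]setTI.
    apply: (@measurable_fun_pair _ _ _ _ _ _ Xe X) => //.
    exact: (discrete_measurableP (countable_discrete_prod (countable_discrete_ctx K De) dD)).
  + by move=> w w' ww'; rewrite (Xen _ _ ww') (Xn _ _ ww').
Qed.

(** * From the triple to noninterference *)

Lemma bernoulli_half_neq0 (A : set bool) (b : bool) :
  A b -> bernoulli_prob (2^-1 : R)%R A != 0.
Proof.
move=> Ab; have p01 : (0 <= (2^-1 : R) <= 1)%R.
  by rewrite invr_ge0 ler0n /= invf_le1// ler1n.
rewrite bernoulli_probE// !diracE -!EFinM -EFinD eqe /unstable.onem.
have A01 c : ((c \in A)%:R : R) = 1%R \/ ((c \in A)%:R : R) = 0%R.
  by case: (c \in A); [left|right].
have Ab1 : ((b \in A)%:R : R) = 1%R by rewrite mem_set.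
rewrite gt_eqF//; case: b Ab Ab1 => _ ->.
  by have [->|->] := A01 false; lra.
by have [->|->] := A01 true; lra.
Qed.

(** Both sides are shown equal to the unconditional law of [Y_1] in one and the same final state. *)
Lemma noninterference_of_hoare :
  hoare R (G := [::])
    (Own (ETuple (ECons (ERnd (VS VZ)) (ECons (ERnd VZ) ENil))))
    M
    (Cond (ERnd (VS (VS VZ)))
       (Sep (Own (ERnd (VS VZ))) (Own (EProj VZ (ERnd VZ))))) ->
  forall (a1 : den_ty K A1) (a2 a2' : den_ty K A2) (V : set (den_ty K B1)),
    den R M (tt, a1, a2) [set y | V y.1] = den R M (tt, a1, a2') [set y | V y.1].
Proof.
move=> hM a1 a2 a2' V.
have dD := countable_discrete_ctx K [:: A2; A1].
have dbool : countable_discrete (Meas bool).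
  by split => //; exact: countableP.
pose coin := bernoulli_prob (2^-1 : R)%R.
(* The coin is stored in coordinate 0 of a point mass, there being no footprint to avoid yet. *)
have [C [mu muE]] := @sample_fresh R (Meas bool) dbool (\d_(point : Omega))%R
  (kprobability (measurable_cst (coin : pprobability bool R))) 0.
have {}muE A : mu (C @^-1` A) = coin A.
  rewrite (muE (fun=> A))//; last by move=> t; exact: measurable_set_cst.
  by rewrite integral_cst// [X in _ * X]probability_setT mule1.
pose x b : den_ctx K [:: A2; A1] := (tt, a1, if b then a2 else a2').
have mX : measurable_fun setT (x \o C).
  by apply: (discrete_measurable_fun dD) => d; rewrite comp_preimage; exact: measurable_funPTI.
pose X0 : {mfun Omega >-> den_ctx K [:: A2; A1]} :=
  HB.pack (x \o C) (isMeasurableFun.Build _ _ _ _ _ mX).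
have X0n : exists n, depends_on_first n X0.
  by have [n Cn] := rv_footprint C; exists n => w w' ww'; rewrite /= (Cn _ _ ww').
pose X : RV R (den_ctx K [:: A2; A1]) := MkRV X0n.
(* Only positivity is claimed: when [a2 = a2'] the event is the whole space. *)
have muX b : mu (X @^-1` [set x b]) != 0.
  by rewrite -[_ @^-1` _]/(C @^-1` (x @^-1` [set x b])) muE (@bernoulli_half_neq0 _ b).
(* A constant variable gives the trivial frame, and serves again as the auxiliary variable of the
   empty context. *)
pose U0 : {mfun Omega >-> munit} := cst tt.
have U0n : exists n, depends_on_first n U0 by exists 0%N.
pose Pf := rv_resource U0 mu; pose P := rv_resource X mu.
have mPf : Mdisint Pf by apply: rv_resource_Mdisint => //; exact: countable_discrete_unit.
have mP : Mdisint P by exact: rv_resource_Mdisint.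
have fr : comb_le Pf P (full mu).
  apply: comb_le_restr; [exact: rsigma_sub|exact: rsigma_sub|].
  move=> _ E /rv_sigmaP[U _ ->] PE.
  rewrite -[rmu Pf _]/(mu (U0 @^-1` U)) -[rmu P E]/(mu E).
  have [Utt|nUtt] := pselect (U tt).
    have -> : U0 @^-1` U = setT by apply/seteqP; split.
    by rewrite setTI probability_setT mul1e.
  have -> : U0 @^-1` U = set0 by apply/seteqP; split.
  by rewrite set0I measure0 mul0e.
have own : sat (Own (ETuple (ECons (ERnd (VS VZ)) (ECons (ERnd VZ) ENil))) :
    formula S [::] [:: A2; A1]) tt X P.
  move=> U mU; apply: (rv_sigma_factor (measurable_eval _ _)) => //.
  exact: rv_sigma_preimage.
have := hM tt X P mP own Pf mPf mu fr [::] (MkRV U0n : RV R (den_ctx K [::])).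
move=> [Y [P' [mu' [mP' fr' condY law]]]].
pose DY := [:: TProd [:: B1; B2]; A2; A1].
pose Z : RV R (den_ctx K DY) := rv_pair X Y.
have rP' : rle P' (full mu').
  split; first exact: rsigma_sub.
  by move=> E P'E; exact: (comb_ler fr').
pose f1 := expr_rv (ERnd (VS (VS VZ)) : expr S _ DY A1) (tt : den_ctx K [::]) Z.
have f1a : f1 @^-1` [set a1] = setT by apply/seteqP; split.
have m1 (U : set (den_ty K A1)) : measurable U.
  exact: (discrete_measurableP (countable_discrete_ty K _)).
pose nu : R.-pker (den_ty K A1) ~> Omega :=
  kprobability (measurable_cst (mu' : pprobability Omega R)).
have dis : disintegration f1 mu' nu.
  split; last first.
    move=> E mE; rewrite -[RHS]/(\int[distribution mu' f1]_s cst (mu' E) s).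
    by rewrite integral_cst// [X in _ * X]probability_setT mule1.
  (* The constant kernel is concentrated on the fibre of [a1] only; the other values are null
     because [f1] is constantly [a1]. *)
  exists (~` [set a1]); split; first exact: m1.
    rewrite -[LHS]/(mu' (f1 @^-1` (~` [set a1]))) -preimage_setC f1a setCT.
    exact: measure0.
  by move=> s /= + sa1; rewrite sa1 f1a; apply; exact: probability_setT.
(* As [a1] carries all the mass, the almost sure postcondition holds at [a1], where the conditional
   measure is [mu'] itself. *)
have /ae_atom : {ae distribution mu' f1, forall a, _} := condY mu' rP' nu dis.
move=> /(_ a1 (m1 _)) [|P1 [P2 [_ _ P12 own1 own2]]].
  have : mu' (f1 @^-1` [set a1]) != 0 by rewrite f1a probability_setT onee_neq0.
  by [].
suff main b : den R M (x b) [set y | V y.1] = mu' [set w | V (Y w).1].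
  by have := main true; rewrite -(main false).
have mV W : measurable (W : set (den_ty K B1)).
  exact: (discrete_measurableP (countable_discrete_ty K _)).
have mb W : measurable (W : set (den_ty K A2)).
  exact: (discrete_measurableP (countable_discrete_ty K _)).
pose b2 : den_ty K A2 := if b then a2 else a2'.
(* This is the law equation of the weakest precondition, read on the event that [X = x b] and [Y_1]
   lies in [W]. *)
have law' W : mu (X @^-1` [set x b]) * den R M (x b) [set y | W y.1] =
    mu' [set w | X w = x b /\ W (Y w).1].
  rewrite -[X @^-1` _]setTI -(integral_kernel_atom X (den R M))//; last first.
    exact: dD.2.
  rewrite -(law [set p | p.1.2 = x b /\ W p.2.1]); last first.
    apply: (discrete_measurableP (countable_discrete_prod
      (countable_discrete_prod (countable_discrete_ctx K [::]) dD)
      (countable_discrete_ty K _))).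
  apply: eq_integral => w _; congr (den R M (X w) _).
  by apply/seteqP; split => [y [[_ Xw] Wy]|y [Xw Wy]]; split.
(* The first component of [X] is constant, so [X = x b] is an event about [X_2] alone, to which the
   independence from [Y_1] applies. *)
pose F2 := [set w | (X w).2 = b2].
have XF2 W : [set w | X w = x b /\ W (Y w).1] = F2 `&` [set w | W (Y w).1].
  apply/seteqP; split => [w [Xw Ww]|w [F2w Ww]]; split => //.
    exact: (congr1 snd Xw).
  by move: F2w; rewrite /F2 /X/= /x/= /b2 => ->.
have indep : mu' (F2 `&` [set w | V (Y w).1]) = mu' F2 * mu' [set w | V (Y w).1].
  have := comb_leE P12 (own1 [set b2] (mb _)) (own2 V (mV _)).
  by rewrite -(comb_lel P12 (own1 _ (mb _))) -(comb_ler P12 (own2 _ (mV _))).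
have muF2 : mu (X @^-1` [set x b]) = mu' F2.
  have := law' setT; rewrite XF2 (_ : [set y | setT y.1] = setT)//.
  by rewrite prob_kernel mule1 -[F2 `&` _]/(F2 `&` setT) setIT.
have p0 : 0 < mu (X @^-1` [set x b]) by rewrite lt0e muX/=.
have mXb : measurable (X @^-1` [set x b]) by apply: measurable_funPTI; exact: dD.2.
(* Multiplied by the mass of [X = x b], the claim becomes the independence of [F2] and [Y_1] under
   [mu']. *)
apply: (mule_pinjl _ p0); first exact: fin_num_measure.
by rewrite law' XF2 indep muF2.
Qed.

End noninterference.

(** * The simulator and the equivalence *)

(** Supplies, within the syntax, the second input that a simulator does not receive. *)
Fixpoint default_const K (S : opsig K) G D (A : ty) : expr S G D A :=
  match A with
  | TBool => EBool false
  | TK => EK 0%R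
  | TIndex => EIndex 0
  | TProd As => ETuple ((fix default_consts (As : seq ty) : exprs S G D As :=
      match As with
      | [::] => ENil
      | A :: As => ECons (default_const S G D A) (default_consts As)
      end) As)
  end.

Theorem theorem1 (R : realType) (K : finZmodType) (S : opsig K)
    (A1 A2 B1 B2 : ty) (M : prog S [:: A2; A1] (TProd [:: B1; B2])) :
  hoare R (G := [::])
    (Own (ETuple (ECons (ERnd (VS VZ)) (ECons (ERnd VZ) ENil))))
    M
    (Cond (ERnd (VS (VS VZ)))
       (Sep (Own (ERnd (VS VZ))) (Own (EProj VZ (ERnd VZ)))))
  <->
  exists Sim : prog S [:: A1] B1,
    forall (a1 : den_ty K A1) (a2 : den_ty K A2) (U : set (den_ty K B1)),
      measurable U ->
      den R Sim (tt, a1) U =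
      den R (Bind M (Return (EProj VZ (ERnd VZ)))) (tt, a1, a2) U.
Proof.
split => [hM|[Sim simM]]; last first.
  have m1 : measurable_fun setT (fun a : den_ty K A1 => (tt, a) : den_ctx K [:: A1]).
    by apply: measurable_fun_pair; [exact: measurable_cst|exact: measurable_id].
  pose i1 : {mfun den_ty K A1 >-> den_ctx K [:: A1]} :=
    HB.pack (fun a : den_ty K A1 => (tt, a) : den_ctx K [:: A1])
      (isMeasurableFun.Build _ _ _ _ _ m1).
  apply: (@hoare_of_simulator _ _ _ _ _ _ _ _ (kpre i1 (den R Sim))) => a1 a2 V.
  have mV : measurable V by exact: (discrete_measurableP (countable_discrete_ty K _)).
  by rewrite -[LHS]/(den R Sim (tt, a1) V) (simM a1 a2)// den_bind_proj1.
(* Binding the constant extends the context by [X_2], so [M] runs as it stands; noninterference then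
   replaces the constant by any [a2]. *)
exists (Bind (Return (default_const S [::] [:: A1] A2))
          (Bind M (Return (EProj VZ (ERnd VZ))))) => a1 a2 U mU.
by rewrite den_bind_return// !den_bind_proj1//; exact: noninterference_of_hoare.
Qed.
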